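(* Let $K\subseteq\mathbf{R}^n$ be a nonempty closed set and let $f=(f_1,\dots,f_s):\mathbf{R}^n\to\mathbf{R}^s$ be a vector polynomial with $\deg f_i=d_i\ge 1$ for $i=1,\dots,s$. Then $\mathrm{PVOP}(K,f)$ is strongly regular and $f$ is bounded from below on $K$ if and only if $SOL(K_\infty,f^\infty_i)=\{0\}$ for all $i\in\{1,\dots,s\}$.
   Context: $\mathbf{R}^s_+$ is the nonnegative orthant. For a nonempty closed set $C\subseteq\mathbf{R}^n$ and a vector polynomial $h:\mathbf{R}^n\to\mathbf{R}^s$, $\mathrm{PVOP}(C,h)$ is the problem of minimizing $h$ over $C$ with respect to $\mathbf{R}^s_+$, and $SOL^{w}(C,h)$ (weak Pareto efficient solutions) is the set of $x^*\in C$ such that $h(x)-h(x^* )\notin-\mathrm{int}\,\mathbf{R}^s_+$ for all $x\in C$. For a scalar polynomial $q$, $SOL(C,q)$ is the set of global minimizers of $q$ over $C$. The asymptotic cone of $K$ is $K_\infty=\{v\in\mathbf{R}^n:\text{ there exist } t_k\to+\infty \text{ and } x_k\in K \text{ with } x_k/t_k\to v\}$. For a vector polynomial $p=(p_1,\dots,p_s)$ with $\deg p_i=d_i$, $p^\infty=(p_1^\infty,\dots,p_s^\infty)$ where $p_i^\infty(x)=\lim_{\lambda\to+\infty}p_i(\lambda x)/\lambda^{d_i}$. $\mathrm{PVOP}(K,f)$ is strongly regular if $SOL^{w}(K_\infty,f^\infty)$ is bounded (the empty set counts as bounded). $f$ is bounded from below on $K$ if there is $r\in\mathbf{R}^s$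 with $f(x)\in r+\mathbf{R}^s_+$ for all $x\in K$. *)

(* Defs.v *)
From mathcomp Require Import all_boot all_order all_algebra.
From mathcomp Require Import all_classical all_reals all_analysis.
(* The notations of mpoly clash with those of mathcomp-analysis. *)
From mathcomp Require mpoly.
Import -(notations) mpoly.

Set Implicit Arguments.
Unset Strict Implicit.
Unset Printing Implicit Defensive.

Import Order.TTheory GRing.Theory Num.Theory.
Import numFieldNormedType.Exports.

Local Open Scope classical_set_scope.
Local Open Scope ring_scope.

Section Defs.
Context {R : realType}.
Implicit Types (n s : nat).

Definition orthant s : set 'rV[R]_s := [set y | forall i, 0 <= y ord0 i].

Definition peval n (p : mpoly.mpoly n R) (x : 'rV[R]_n) : R :=
  mpoly.meval (fun j => x ord0 j) p.

(* [msize p] is one more than the total degree, and [msize 0 = 0]; hence a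
   polynomial with [1 <= pdeg p] is nonzero and nonconstant. *)
Definition pdeg n (p : mpoly.mpoly n R) : nat := (mpoly.msize p).-1.

Definition pinfty n (p : mpoly.mpoly n R) (x : 'rV[R]_n) : R :=
  lim ((fun l : R => peval p (l *: x) / l ^+ pdeg p) @ +oo).

Definition vpeval n s (f : 'I_s -> mpoly.mpoly n R) (x : 'rV[R]_n) : 'rV[R]_s :=
  \row_i peval (f i) x.

Definition vpinfty n s (f : 'I_s -> mpoly.mpoly n R) (x : 'rV[R]_n) :
  'rV[R]_s := \row_i pinfty (f i) x.

Definition SOL n (C : set 'rV[R]_n) (q : 'rV[R]_n -> R) : set 'rV[R]_n :=
  [set x | C x /\ forall y, C y -> q x <= q y].

Definition SOLw n s (C : set 'rV[R]_n) (h : 'rV[R]_n -> 'rV[R]_s) :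
    set 'rV[R]_n :=
  [set x | C x /\
    forall y, C y ->
      ~ [set - z | z in (interior (@orthant s) : set 'rV[R]_s)] (h y - h x)].

Definition asymptotic_cone n (K : set 'rV[R]_n) : set 'rV[R]_n :=
  [set v | exists (t : nat -> R) (x : nat -> 'rV[R]_n),
    [/\ t @ \oo --> +oo, forall k, K (x k) &
        (fun k => (t k)^-1 *: x k) @ \oo --> v]].

Definition strongly_regular n s (K : set 'rV[R]_n)
    (f : 'I_s -> mpoly.mpoly n R) : Prop :=
  bounded_set (SOLw (asymptotic_cone K) (vpinfty f)).

Definition bounded_below_on n s (K : set 'rV[R]_n)
    (h : 'rV[R]_n -> 'rV[R]_s) : Prop :=
  exists r : 'rV[R]_s,
    forall x, K x -> [set r + y | y in @orthant s] (h x).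

End Defs.

(* Main.v *)
(* The recession map of [p] is its leading form, and [p (t u) / t ^ d] tends to
   [leading_form p v] as [t] tends to infinity and [u] to [v], jointly. Hence
   boundedness below on [K] makes the leading forms nonnegative on the asymptotic
   cone, so that a nonzero zero of one of them spans a ray of weak Pareto points.
   Conversely, if the leading forms are positive off the origin, then the origin
   strictly dominates every other point of the cone, and compactness of the unit
   sphere gives the lower bounds on [K]. *)

Require Import Defs.
From mathcomp Require Import all_boot all_order all_algebra.
From mathcomp Require Import all_classical all_reals all_analysis.
From mathcomp Require mpoly.
Import -(notations) mpoly.
Import Order.TTheory GRing.Theory Num.Theory.
Import numFieldNormedType.Exports.
Local Open Scope classical_set_scope.
Local Open Scope ring_scope.

(** * Leading forms and limits of scaled polynomials *)

Section leading_form.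
Context {R : realType} {n : nat}.
Implicit Types (p : mpoly n R) (v : 'rV[R]_n).

(* Only the monomials of top degree survive, since [0 ^+ k] is [k == 0]. *)
Definition leading_form p v : R :=
  \sum_(m <- msupp p)
    mcoeff m p * (\prod_i v ord0 i ^+ m i) * 0 ^+ (pdeg p - mdeg m).

Lemma mdeg_le_pdeg p m : m \in msupp p -> (mdeg m <= pdeg p)%N.
Proof. by move=> /msize_mdeg_lt; rewrite /pdeg; case: (msize p). Qed.

Lemma prod_scale_exp (m : multinom n) (c : R) v :
  \prod_i (c *: v) ord0 i ^+ m i = c ^+ mdeg m * \prod_i v ord0 i ^+ m i.
Proof.
rewrite mdegE expr_sum -big_split /=.
by apply: eq_bigr => i _; rewrite mxE exprMn.
Qed.

Lemma leading_formZ p (c : R) v :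
  leading_form p (c *: v) = c ^+ pdeg p * leading_form p v.
Proof.
rewrite /leading_form mulr_sumr; apply: eq_big_seq => m /mdeg_le_pdeg.
rewrite leq_eqVlt prod_scale_exp => /predU1P[->|lt_md].
  by rewrite subnn !mulr1 mulrCA.
(* Below the top degree both sides carry a positive power of 0. *)
have /negPf md_neq0 : (pdeg p - mdeg m)%N != 0%N by rewrite -lt0n subn_gt0.
by rewrite expr0n md_neq0 !mulr0.
Qed.

Lemma leading_form0 p : (0 < pdeg p)%N -> leading_form p 0 = 0.
Proof.
move=> d_gt0; have := leading_formZ p 0 0.
by rewrite scale0r expr0n eqn0Ngt d_gt0 mul0r.
Qed.

Lemma coord_expr_prod_cvg {T : Type} {F : set_system T} {FF : Filter F}
    (u : T -> 'rV[R]_n) v (m : multinom n) :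
  u @ F --> v ->
  (fun k => \prod_i u k ord0 i ^+ m i) @ F --> \prod_i v ord0 i ^+ m i.
Proof.
move=> uv; apply: cvg_big => [|i _]; first exact: mul_continuous.
apply: (cvg_comp (fun k => u k ord0 i) (fun x => x ^+ m i)); last first.
  exact: exprn_continuous.
exact: (cvg_comp _ _ uv (@coord_continuous R 1 n ord0 i v)).
Qed.

Lemma peval_continuous p : continuous (peval p).
Proof.
have -> : peval p = fun v => \sum_(m <- msupp p)
    mcoeff m p * \prod_i v ord0 i ^+ m i by apply/funext => v; exact: mevalE.
move=> v.
have coord_cvg m := coord_expr_prod_cvg (F := nbhs v) id v m cvg_id.
apply: (cvg_big _ (nbhs_filter v)) => [|m _]; first exact: add_continuous.
by apply: cvgM; [exact: cvg_cst|exact: coord_cvg].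
Qed.

(** Dividing by [t ^ d] leaves a monomial of degree [e] with the factor [(1/t) ^ (d - e)], whose
    limit is the power of 0 in [leading_form]. An arbitrary filter serves both the real limit in
    [pinfty] and the sequences of [asymptotic_cone]. *)
Lemma peval_ratio_cvg {T : Type} {F : set_system T} {FF : Filter F} p
    (t : T -> R) (u : T -> 'rV[R]_n) v :
  t @ F --> +oo -> u @ F --> v ->
  (fun k => peval p (t k *: u k) / t k ^+ pdeg p) @ F --> leading_form p v.
Proof.
move=> ty uv.
have t_gt0 : \forall k \near F, 0 < t k by exact: (cvgryPgt _).1.
have tV0 : (fun k => (t k)^-1) @ F --> (0 : R) by exact/gtr0_cvgV0.
have expand : \forall k \near F,
    \sum_(m <- msupp p) mcoeff m p * (\prod_i u k ord0 i ^+ m i)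
       * (t k)^-1 ^+ (pdeg p - mdeg m)
    = peval p (t k *: u k) / t k ^+ pdeg p.
  near=> k; have tk0 : t k != 0 by rewrite gt_eqF//; near: k.
  rewrite /peval mevalE mulr_suml; apply: eq_big_seq => m /mdeg_le_pdeg le_md.
  rewrite prod_scale_exp -{2}(subnK le_md) exprD invfM exprVn.
  rewrite mulrACA [_ / t k ^+ mdeg m]mulrAC divff ?expf_neq0// mul1r.
  exact: mulrAC.
apply: cvg_trans (near_eq_cvg expand) _.
apply: cvg_big => [|m _]; first exact: add_continuous.
apply: cvgM; last first.
  apply: (cvg_comp (fun k => (t k)^-1) (fun x => x ^+ _) tV0).
  exact: exprn_continuous.
apply: cvgM; first exact: cvg_cst.
exact: coord_expr_prod_cvg.
Unshelve. all: by end_near. Qed.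

Lemma pinftyE p : pinfty p = leading_form p.
Proof.
apply/funext => v; apply: cvg_lim; first exact: Rhausdorff.
by apply: (peval_ratio_cvg p (fun l => l) (fun=> v)); [|exact: cvg_cst].
Qed.

End leading_form.

(** * The interior of the orthant *)

Lemma interior_orthantE (R : realType) s :
  interior (@orthant R s) = [set z | forall i, 0 < z ord0 i].
Proof.
apply/seteqP; split=> z /=.
  move=> z_int i.
  (* Subtracting a small [e > 0] from every coordinate of an interior point stays in the orthant, so
     each coordinate is at least [e]. *)
  have shift_cvg : (fun e : R => z - e *: const_mx 1) @ 0^'+ --> z.
    rewrite -[X in _ --> X]subr0 -(scale0r (const_mx 1)).
    apply: cvgB; first exact: cvg_cst.
    apply: cvgZr_tmp; exact/cvg_at_right_filter/cvg_id.
  have shifted : \forall e \near (0 : R)^'+, orthant (z - e *: const_mx 1).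
    exact: (shift_cvg _ z_int).
  have [e [e_gt0 /(_ i)]] := filter_ex
    (filterI (nbhs_right_gt (0 : R)) shifted).
  by rewrite !mxE mulr1 subr_ge0; exact: lt_le_trans.
move=> z_gt0; rewrite /interior /orthant.
apply: (@filter_forall _ _
  (fun i (y : 'rV[R]_s) => 0 <= y ord0 i) (nbhs z)) => i.
have ci := @coord_continuous R 1 s ord0 i z.
near=> y; apply: ltW; near: y.
exact: (cvgr_gt _ ci).
Unshelve. all: by end_near. Qed.

(** * Asymptotic cones and lower bounds of polynomials *)

Section asymptotic_cone.
Context {R : realType} {n : nat}.
Implicit Types (K : set 'rV[R]_n) (v : 'rV[R]_n).

Lemma asymptotic_cone0 K : K !=set0 -> asymptotic_cone K 0.
Proof.
move=> [x Kx]; exists (fun k => k%:R), (fun=> x); split=> //.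
  exact: cvgr_idn.
rewrite -[X in _ --> X](scale0r x).
apply: cvgZr_tmp; apply/gtr0_cvgV0; last exact: cvgr_idn.
by near=> k; rewrite ltr0n; near: k; exact: nbhs_infty_gt.
Unshelve. all: by end_near. Qed.

Lemma asymptotic_coneZ K c v :
  0 < c -> asymptotic_cone K v -> asymptotic_cone K (c *: v).
Proof.
move=> c_gt0 [t [x [ty Kx xv]]].
exists (fun k => t k * c^-1), x; split=> //.
  apply: (cvg_comp t (fun r => r * c^-1) ty).
  by apply: gt0_cvgMly; rewrite ?invr_gt0//; exact: cvg_id.
under eq_fun do rewrite invfM invrK mulrC -scalerA.
exact: cvgZl_tmp.
Qed.

(** The directions lie on the compact unit sphere, hence have a cluster point. *)
Lemma asymptotic_direction (x : nat -> 'rV[R]_n) :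
  (forall k, k%:R < `|x k|) ->
  exists (v : 'rV[R]_n) (phi : nat -> nat),
    [/\ `|v| = 1, (fun k => `|x (phi k)|) @ \oo --> +oo &
        (fun k => `|x (phi k)|^-1 *: x (phi k)) @ \oo --> v].
Proof.
move=> x_big; have x_gt0 k : 0 < `|x k| := le_lt_trans (ler0n _ _) (x_big k).
pose u k := `|x k|^-1 *: x k.
have u1 k : `|u k| = 1.
  by rewrite normrZ normfV normr_id mulVf// gt_eqF.
pose S : set 'rV[R]_n := [set y | `|y| = 1].
have S_compact : compact S.
  apply: bounded_closed_compact.
    exists 1; split; first exact: num_real.
    by move=> M M1 y /= ->; exact: ltW.
  apply: (@preimage_closed _ _ (fun y : 'rV[R]_n => `|y|) [set 1]).
    by move=> y _; exact: norm_continuous.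
  exact: closed_eq.
have [|v [v1 v_cluster]] := S_compact (u @ \oo) _.
  exact: (@filterE _ \oo).
(* Indices beyond [k] within [1/(k+1)] of [v] turn clustering into convergence. The resulting [phi]
   need not be increasing: [k <= phi k] already forces the norms to infinity. *)
have close k : exists m, (k <= m)%N /\ `|v - u m| < k.+1%:R^-1.
  have tail : (u @ \oo) [set u m | m in [set m | (k <= m)%N]].
    by apply: (@filterS _ \oo) (nbhs_infty_ge k) => m km; exists m.
  have ballv : nbhs v (ball v (k.+1%:R^-1)).
    by apply: nbhsx_ballx; rewrite invr_gt0.
  have [_ [[m km <-]]] := v_cluster _ _ tail ballv.
  by rewrite -ball_normE => um; exists m.
have [phi phiP] := choice close.
exists v, phi; split=> //.
  apply/cvgryPgt => A; near=> k.
  apply: lt_trans (x_big _); apply: (@lt_le_trans _ _ k%:R); last first.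
    by rewrite ler_nat; case: (phiP k).
  near: k; exact: nbhs_infty_gtr.
apply/cvgrPdist_lt => e e_gt0; near=> k.
apply: lt_trans (phiP k).2 _; near: k.
exact: near_infty_natSinv_lt (PosNum e_gt0).
Unshelve. all: by end_near. Qed.

(** Divide [r <= p x] by [t ^ d] along a sequence defining [v]: the left side vanishes in the limit
    because [d > 0]. *)
Lemma leading_form_ge0 K p r v :
  (0 < pdeg p)%N -> (forall x, K x -> r <= peval p x) ->
  asymptotic_cone K v -> 0 <= leading_form p v.
Proof.
move=> d_gt0 r_le [t [x [ty Kx xv]]].
have t_gt0 : \forall k \near \oo, 0 < t k by exact: (cvgryPgt _).1.
have lim1 := peval_ratio_cvg (FF := eventually_filter) p t _ v ty xv.
have lim0 : (fun k => r * (t k)^-1 ^+ pdeg p) @ \oo --> r * 0 ^+ pdeg p.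
  apply: cvgM; first exact: cvg_cst.
  apply: (cvg_comp (fun k => (t k)^-1) (fun x => x ^+ _)).
    exact/gtr0_cvgV0.
  exact: exprn_continuous.
rewrite expr0n eqn0Ngt d_gt0 mulr0 in lim0.
apply: (ler_cvg_to lim0 lim1); near=> k.
have tk_gt0 : 0 < t k by near: k.
rewrite scalerA divff ?gt_eqF// scale1r exprVn.
by rewrite ler_pM2r ?invr_gt0 ?exprn_gt0//; exact: r_le.
Unshelve. all: by end_near. Qed.

(* A sequence along which [p] is negative escapes every ball, where [p] is
   bounded, so its directions accumulate at a point of the asymptotic cone where
   the leading form is nonpositive. *)
Lemma leading_form_gt0_bounded K p :
  (forall v, asymptotic_cone K v -> v != 0 -> 0 < leading_form p v) ->
  exists r, forall x, K x -> r <= peval p x.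
Proof.
move=> pos; apply: contrapT => /forallNP unbounded.
have ball_bound k : exists r, forall x : 'rV[R]_n,
    `|x| <= k%:R -> r <= peval p x.
  have k_compact : compact [set x : 'rV[R]_n | `|x| <= k%:R].
    apply: bounded_closed_compact.
      exists k%:R; split; first exact: num_real.
      by move=> M kM y /= /le_trans; apply; exact: ltW.
    apply: (@preimage_closed _ _ (fun y : 'rV[R]_n => `|y|)
      [set y | y <= k%:R]).
      by move=> y _; exact: norm_continuous.
    exact: closed_le.
  have [|c _ c_min] := EVT_min_rV _ k_compact
    (continuous_subspaceT (peval_continuous p)).
    by exists 0 => /=; rewrite normr0.
  by exists (peval p c) => x xk; apply: c_min; rewrite inE.
have far k : exists x, [/\ K x, k%:R < `|x| & peval p x < 0].
  have [r rP] := ball_bound k.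
  have /existsNP[x /not_implyP[Kx /negP]] := unbounded (Num.min r 0).
  rewrite -ltNge lt_min => /andP[xr x0]; exists x; split=> //.
  by rewrite ltNge; apply/negP => /rP; rewrite leNgt xr.
have [x xP] := choice far.
have [k|v [phi [v1 ty xv]]] := asymptotic_direction x.
  by case: (xP k).
have v_neq0 : v != 0 by rewrite -normr_eq0 v1 oner_neq0.
have cone_v : asymptotic_cone K v.
  exists (fun k => `|x (phi k)|), (x \o phi); split=> // k /=.
  by case: (xP (phi k)).
have := pos v cone_v v_neq0; rewrite ltNge => /negP; apply.
apply: cvgr_to_le (peval_ratio_cvg p _ _ v ty xv) _.
near=> k; have [_ _ xk_lt0] := xP (phi k).
have xk_gt0 : 0 < `|x (phi k)|.
  by apply: le_lt_trans (ler0n _ (phi k)) _; case: (xP (phi k)).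
rewrite scalerA divff ?gt_eqF// scale1r.
by rewrite pmulr_lle0 ?invr_gt0 ?exprn_gt0// ltW.
Unshelve. all: by end_near. Qed.

End asymptotic_cone.

(** * Strong regularity and the recession problems *)

Theorem proposition3p5 (R : realType) (n s : nat) (K : set 'rV[R]_n)
    (f : 'I_s -> mpoly.mpoly n R)
    (K_neq0 : K !=set0) (K_closed : closed K)
    (deg_f : forall i : 'I_s, (1 <= pdeg (f i))%N) :
  (strongly_regular K f /\ bounded_below_on K (vpeval f)) <->
  (forall i : 'I_s, SOL (asymptotic_cone K) (pinfty (f i)) = [set 0]).
Proof.
have cone0 := asymptotic_cone0 K K_neq0.
split=> [[[M [_ SOLw_bound]] [r f_ge]] i|SOL0].
  have ge0 : forall v, asymptotic_cone K v -> 0 <= leading_form (f i) v.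
    move=> v; apply: (@leading_form_ge0 _ _ _ _ (r ord0 i)) => // x Kx.
    have [y /(_ i) y_ge0 /(congr1 (fun z : 'rV[R]_s => z ord0 i))] := f_ge x Kx.
    by rewrite !mxE => <-; rewrite lerDl.
  rewrite pinftyE; apply/seteqP; split=> v /=; last first.
    by move=> ->; split=> // y /ge0; rewrite leading_form0.
  move=> [cone_v v_min].
  have v_zero : leading_form (f i) v = 0.
    apply/eqP; rewrite eq_le ge0// andbT.
    by rewrite -(leading_form0 (f i) (deg_f i)); exact: v_min.
  (* The whole ray through [v] consists of minimizers of the i-th form. *)
  have ray c : 0 < c -> SOLw (asymptotic_cone K) (vpinfty f) (c *: v).
    move=> c_gt0; split; first exact: asymptotic_coneZ.
    (* A point of the cone strictly dominating [c *: v] would have a negative i-th form. *)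
    move=> y /ge0 y_ge0 [z]; rewrite interior_orthantE => /(_ i) z_gt0.
    move=> /(congr1 (fun z : 'rV[R]_s => z ord0 i)).
    rewrite !mxE pinftyE leading_formZ v_zero mulr0 subr0 => zy.
    by move: y_ge0; rewrite -zy oppr_ge0 leNgt z_gt0.
  apply/eqP/negPn/negP => v_neq0; rewrite -normr_gt0 in v_neq0.
  (* [SOLw_bound] applies only to radii above [M], which may be negative; the ray point of norm
     [B + 1] then violates the bound [B]. *)
  pose B := `|M| + 1; have B_gt0 : 0 < B by rewrite ltr_wpDl.
  have MB : M < B by rewrite (le_lt_trans (ler_norm M))// ltrDl.
  have c_gt0 : 0 < (B + 1) / `|v| by rewrite divr_gt0// addr_gt0.
  have := SOLw_bound B MB _ (ray _ c_gt0).
  rewrite /= normrZ gtr0_norm// mulfVK ?gt_eqF//.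
  by rewrite leNgt ltrDl ltr01.
have pos i v : asymptotic_cone K v -> v != 0 -> 0 < leading_form (f i) v.
  move=> cone_v v_neq0; rewrite -(leading_form0 (f i) (deg_f i)).
  have [_ min0] : SOL (asymptotic_cone K) (pinfty (f i)) 0 by rewrite SOL0.
  (* If the form vanished at [v], then [v] would be a second minimizer besides the origin. *)
  rewrite lt_neqAle -pinftyE min0// andbT; apply/negP => /eqP eq_v.
  suff : SOL (asymptotic_cone K) (pinfty (f i)) v.
    by rewrite SOL0 => /eqP; exact/negP.
  by split=> // y /min0; rewrite eq_v.
split.
  (* The bound 0 suffices, since a nonzero [v] in the cone is strictly dominated by the origin. *)
  exists 0; split; first exact: num_real.
  move=> M M_gt0 v [cone_v v_wk]; have [->|v_neq0] := eqVneq v 0.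
    by rewrite /= normr0 ltW.
  exfalso; apply: (v_wk 0 cone0); exists (vpinfty f v).
    by rewrite interior_orthantE => i; rewrite mxE pinftyE; exact: pos.
  by apply/rowP => i; rewrite !mxE !pinftyE leading_form0// sub0r.
have [r rP] := choice (fun i => leading_form_gt0_bounded K (f i) (pos i)).
exists (\row_i r i) => x Kx; exists (vpeval f x - \row_i r i).
  by move=> i; rewrite !mxE subr_ge0; exact: rP.
by rewrite addrC subrK.
Qed.
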